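(* Choose any decay factor $\alpha\in(0,1)$, failure probability $p\in(0,1)$, and any functions $\varepsilon(n)\in(0,1)$ and $m(n)\in\Omega(n)\cap O(n^2)$. Consider any (possibly randomized) algorithm in the arc-centric graph query model which, for an arbitrary directed graph $G$ with $O(m)$ edges and $O(n)$ nodes and any source node $s$ of $G$, with probability at least $1-p$ gives an estimate $\hat\pi(s,\cdot)$ of the PPR vector $\pi(s,\cdot)$ satisfying $|\hat\pi(s,v)-\pi(s,v)|\le\varepsilon$ for each node $v$. Then there exist a graph $\mathrm U$ and a source node $s$ such that (i) $\mathrm U$ contains $O(m)$ edges and $O(n)$ nodes; (ii) the algorithm requires $\Omega\!\left(\min\left(m,\frac{1}{\varepsilon^2}\right)\right)$ queries to succeed in expectation.
   Context: Graphs are directed, without parallel edges (self-loops allowed). Personalized PageRank (PPR): for a decay factor $\alpha\in(0,1)$, an $\alpha$-decay random walk from $s$ at each step stops at the current node with probability $\alpha$, and with probability $1-\alpha$ moves to a uniformly random out-neighbour of the current node. $\pi(s,t)$ is the probability that the walk started at $s$ terminates at $t$. It is assumed, without loss of generality, that graphs have no dangling nodes (nodes without out-neighbours). The parameters $\alpha,p$ are treated as constants in the asymptotic notation. Arc-centric graph query model: nodes carry labels in $\{1,\dots,|V|\}$; the out-edges (in-edges) of a node $v$ are indexed by $1,\dots,d_{out}(v)$ (resp. $1,\dots,d_{in}(v)$); a graph instance includes these labels. The algorithm is given $s$ (which is covered) and accesses $G$ only via unit-cost queries: JUMP() returns a uniformly random node and marks it covered; INDEG$(v)$/OUTDEG$(v)$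 return the in-/out-degree of a covered node $v$; ADJ$_{in}(v,i)$/ADJ$_{out}(v,i)$ return the $i$-th in-/out-neighbour of a covered node $v$ (which then becomes covered).
   Formalization: The bound is proved for the maximum of 1 and the expected number of queries, since for constant ε ≥ 1/2 returning 1/2 at every node succeeds with zero queries; whenever the constant times min(m, 1/ε²) exceeds 1 it bounds the expected queries themselves. *)

(* Defs.v *)
From HB Require Import structures.
From mathcomp Require Import all_boot all_order all_algebra.
From mathcomp Require Import all_classical all_reals all_analysis.
Set Implicit Arguments.
Unset Strict Implicit.
Unset Printing Implicit Defensive.
Import Order.TTheory GRing.Theory Num.Theory.
Import numFieldNormedType.Exports.
Local Open Scope classical_set_scope.
Local Open Scope ring_scope.

(** A graph instance.  A node is identified with its label, and labels run over
    0, ..., nnodes - 1.  The lists [outs v] and [ins v] carry the numbering of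
    the out- and in-edges of [v] (indices start at 0); the two numberings are
    independent of each other.  Self-loops are allowed, parallel edges and
    dangling nodes are not. *)
Record digraph := Digraph {
  nnodes : nat;
  outs : 'I_nnodes -> seq 'I_nnodes;
  ins : 'I_nnodes -> seq 'I_nnodes;
  outs_uniq : forall v, uniq (outs v);
  ins_uniq : forall v, uniq (ins v);
  mem_ins : forall u v, (u \in ins v) = (v \in outs u);
  no_dangling : forall v, outs v != [::] }.

Definition outdeg (G : digraph) (v : 'I_(nnodes G)) : nat := size (outs v).

Definition indeg (G : digraph) (v : 'I_(nnodes G)) : nat := size (ins v).

Definition nedges (G : digraph) : nat := (\sum_(v < nnodes G) outdeg v)%N.

(** The probability that the alpha-decay walk from [s] makes at least [k] moves
    and is at [v] after the [k]-th one. *)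
Fixpoint walk_at (R : realType) (alpha : R) (G : digraph) (s : 'I_(nnodes G))
    (k : nat) (v : 'I_(nnodes G)) : R :=
  if k is k'.+1 then
    \sum_(u < nnodes G | v \in outs u)
      walk_at alpha s k' u * ((1 - alpha) / (outdeg u)%:R)
  else (v == s)%:R.

(** The term of index [k] is the probability of terminating at [t] after
    exactly [k] moves. *)
Definition ppr (R : realType) (alpha : R) (G : digraph)
    (s t : 'I_(nnodes G)) : R :=
  limn (series (fun k => walk_at alpha s k t * alpha)).

Inductive query :=
  | Jump
  | InDeg of nat
  | OutDeg of nat
  | AdjIn of nat & nat
  | AdjOut of nat & nat.

(** What the algorithm has seen so far, oldest query first.  [None] is the
    answer to a query about a node that is not covered, or for an edge index
    that is out of range. *)
Definition history := seq (query * option nat).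

Definition covered_by (e : query * option nat) : option nat :=
  match e.1 with
  | Jump | AdjIn _ _ | AdjOut _ _ => e.2
  | InDeg _ | OutDeg _ => None
  end.

Definition covered (s : nat) (h : history) : seq nat := s :: pmap covered_by h.

Definition ask_node (G : digraph) (s : 'I_(nnodes G)) (h : history) (v : nat)
    (f : 'I_(nnodes G) -> option nat) : option nat :=
  if v \in covered s h then obind f (insub v) else None.

(** The list of the equally likely answers to a query; it is a singleton except
    for [Jump]. *)
Definition answers (G : digraph) (s : 'I_(nnodes G)) (h : history) (q : query) :
    seq (option nat) :=
  match q with
  | Jump => [seq Some (val v) | v <- enum 'I_(nnodes G)]
  | InDeg v => [:: ask_node s h v (fun u => Some (indeg u))]
  | OutDeg v => [:: ask_node s h v (fun u => Some (outdeg u))]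
  | AdjIn v i => [:: ask_node s h v (fun u => omap val (onth (ins u) i))]
  | AdjOut v i => [:: ask_node s h v (fun u => omap val (onth (outs u) i))]
  end.

Definition mean (R : realType) (l : seq (option nat)) (f : option nat -> R) : R :=
  (\sum_(a <- l) f a) / (size l)%:R.

(** The next move of an algorithm; a returned estimate maps labels to reals, and
    only its values at the labels of the graph matter. *)
Inductive action (R : realType) :=
  | Ask of query
  | Return of (nat -> R).

Arguments Ask {R} _.

(** A randomized algorithm: an arbitrary probability space of internal coins,
    and for every outcome a deterministic strategy choosing the next action from
    the label of the source and the history.  The answers to [Jump] are drawn
    independently of the coins.  The last two fields say that the choice of each
    action is a measurable function of the coins. *)
Record algorithm (R : realType) := Algorithm {
  coins_display : measure_display;
  coins : measurableType coins_display;
  coins_law : probability coins R;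
  strategy : coins -> nat -> history -> action R;
  measurable_ask : forall s h q,
    measurable [set w : coins | strategy w s h = Ask q];
  measurable_return : forall s h v (r : R),
    measurable [set w : coins |
      exists2 est, strategy w s h = Return est & est v <= r] }.

Definition accurate (R : realType) (alpha eps : R) (G : digraph)
    (s : 'I_(nnodes G)) (est : nat -> R) : bool :=
  [forall v : 'I_(nnodes G), `|est (val v) - ppr alpha s v| <= eps].

(** For fixed coins, the probability over the answers to [Jump] that a run with
    history [h] halts after at most [k] further queries, with an accurate
    estimate. *)
Fixpoint success_within (R : realType) (alpha eps : R) (G : digraph)
    (s : 'I_(nnodes G)) (st : history -> action R) (k : nat) (h : history) : R :=
  match st h with
  | Return est => (accurate alpha eps s est)%:R
  | Ask q =>
      if k is k'.+1 then
        mean (answers s h q)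
          (fun a => success_within alpha eps s st k' (rcons h (q, a)))
      else 0
  end.

(** For fixed coins, the expectation over the answers to [Jump] of min(T, k),
    where T is the number of further queries of a run with history [h]. *)
Fixpoint mean_queries_upto (R : realType) (G : digraph)
    (s : 'I_(nnodes G)) (st : history -> action R) (k : nat) (h : history) : R :=
  match st h with
  | Return _ => 0
  | Ask q =>
      if k is k'.+1 then
        1 + mean (answers s h q)
              (fun a => mean_queries_upto s st k' (rcons h (q, a)))
      else 0
  end.

Definition success_prob (R : realType) (alpha eps : R) (A : algorithm R)
    (G : digraph) (s : 'I_(nnodes G)) : \bar R :=
  (\int[coins_law A]_w
     limn (fun k =>
       (success_within alpha eps s (strategy w (val s)) k [::])%:E))%E.

(** This is +oo if the runs of [A] do not halt almost surely. *)
Definition expected_queries (R : realType) (A : algorithm R)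
    (G : digraph) (s : 'I_(nnodes G)) : \bar R :=
  (\int[coins_law A]_w
     limn (fun k => (mean_queries_upto s (strategy w (val s)) k [::])%:E))%E.

(** At most [C * n] nodes and at most [C * m] edges. *)
Definition of_size (R : realType) (C : R) (n m : nat) (G : digraph) : Prop :=
  (nnodes G)%:R <= C * n%:R /\ (nedges G)%:R <= C * m%:R.

(* Main.v *)
(** The hidden data are the bits of a D x D matrix b with D^2 of order
    min(m, 1/eps^2).  In the graph of b the walk from the source reaches the sink
    [Sink true] with probability (1 - alpha)^3 |b| / D^2, while the degrees do not
    depend on b and each position of an adjacency list depends on a single entry
    of b, so that a query reveals at most one bit.  Average over uniform b.  As
    long as fewer than half of the bits are known, |b| is a constant plus a
    binomial variable with at least D^2/2 trials, which falls in the window of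
    width O(eps D^2) allowed by an accurate estimate with probability at most
    (1 - p)/2.  By induction on the run, the success probability is at most
    (1 - p)/2 plus the expected number of queries divided by D^2/2, whence some b
    needs (1 - p) D^2 / 4 queries in expectation. *)

Require Import Defs.
From HB Require Import structures.
From mathcomp Require Import all_boot all_order all_algebra.
From mathcomp Require Import all_classical all_reals all_analysis.
From mathcomp Require Import measurable_realfun zify ring lra.
Set Implicit Arguments.
Unset Strict Implicit.
Unset Printing Implicit Defensive.
Import Order.TTheory GRing.Theory Num.Theory.
Import numFieldNormedType.Exports.
Local Open Scope classical_set_scope.
Local Open Scope ring_scope.

(** * Anti-concentration of the binomial distribution *)

(** By symmetry let k = m + j; there the ratio of consecutive coefficients is (m - j) / (m + j + 1)
    <= 1. *)
Lemma bin_double_le m k : ('C(m.*2, k) <= 'C(m.*2, m))%N.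
Proof.
have above j : ('C(m.*2, m + j) <= 'C(m.*2, m))%N.
  elim: j => [|j IHj]; first by rewrite addn0.
  apply: leq_trans IHj; rewrite addnS.
  rewrite -(leq_pmul2l (ltn0Sn (m + j))) mul_bin_left leq_mul2r.
  by apply/orP; right; lia.
have [m_le_k | k_lt_m] := leqP m k; first by rewrite -(subnKC m_le_k).
rewrite -bin_sub; last lia.
by have -> : (m.*2 - k = m + (m - k))%N by lia.
Qed.

(** Root-free form of C(2m, m) <= 4^m / sqrt (2m + 1), by induction from (m + 1) C(2m + 2, m + 1) =
    2 (2m + 1) C(2m, m) and (2m + 1) (2m + 3) <= 4 (m + 1)^2. *)
Lemma central_bin_sqr_le m : ('C(m.*2, m) ^ 2 * m.*2.+1 <= 16 ^ m)%N.
Proof.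
elim: m => [|m IHm]; first by rewrite bin0.
have step : ('C(m.+1.*2, m.+1) * m.+1 = 2 * m.*2.+1 * 'C(m.*2, m))%N.
  have E : ('C(m.*2.+1, m) = 'C(m.*2.+1, m.+1))%N.
    by rewrite -bin_sub; [congr 'C(_, _)|]; lia.
  by rewrite doubleS binS E -mulnA (mul_bin_diag m.*2.+1 m); ring.
rewrite -(@leq_pmul2l (m.+1 ^ 2)) ?expn_gt0 // mulnA -expnMn mulnC.
rewrite [(m.+1 * _)%N]mulnC step (expnS 16).
have : (m.*2.+1 * m.+1.*2.+1 <= 4 * m.+1 ^ 2)%N by rewrite -!muln2; nia.
move: IHm; set B := 'C(_, _); set E := (16 ^ m)%N.
set a := m.*2.+1; set b := m.+1.*2.+1; set c := (m.+1 ^ 2)%N.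
move=> IHm abc.
have : ((B ^ 2 * a) * (a * b) <= E * (4 * c))%N by apply: leq_mul.
by rewrite -(leq_pmul2l (isT : 0 < 4)%N) => h; apply: etrans h; congr (_ <= _)%N; ring.
Qed.

(** Root-free form of C(n, k) <= 2^n / sqrt n; Pascal's rule reduces odd [n] to even ones. *)
Lemma bin_sqr_le n k : ('C(n, k) ^ 2 * n <= 4 ^ n)%N.
Proof.
have e16 m : (4 ^ m.*2 = 16 ^ m)%N by rewrite -mul2n expnM.
rewrite -(odd_double_half n); set m := n./2; case: (odd n) => /=.
  rewrite add1n (expnS 4) e16.
  have : ('C(m.*2.+1, k) <= 2 * 'C(m.*2, m))%N.
    case: k => [|k]; last first.
      by rewrite binS; have := leq_add (bin_double_le m k.+1) (bin_double_le m k); lia.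
    by have := bin_double_le m 0; rewrite !bin0; lia.
  rewrite -leq_sqr => h; apply: leq_trans (leq_mul h (leqnn _)) _.
  by rewrite expnMn -mulnA leq_mul2l central_bin_sqr_le.
rewrite add0n e16; have := bin_double_le m k; rewrite -leq_sqr => h.
by apply: leq_trans (central_bin_sqr_le m); apply: leq_mul.
Qed.

Section AntiConcentration.
Variables (R : realType) (T : finType).
Implicit Types (K b c : {set T}).

(** The inputs still possible once the entries in [K] have been read and found as in [c]. *)
Definition cylinder K c : {set {set T}} := [set b | b :&: K == c :&: K].

Lemma card_cylinder K c : (2 ^ #|~: K| <= #|cylinder K c|)%N.
Proof.
rewrite -card_powerset -(@card_in_imset _ _ (fun A => A :|: (c :&: K))).
  apply: subset_leq_card; apply/fintype.subsetP => _ /imsetP[A + ->].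
  rewrite powersetE inE => /fintype.subsetP AK.
  apply/eqP/finset.setP => x; rewrite !inE; have := AK x; rewrite inE.
  by case: (x \in A) => [/(_ isT)/negbTE->|_]; case: (x \in c); case: (x \in K).
move=> A B; rewrite !powersetE => /fintype.subsetP AK /fintype.subsetP BK.
move=> /finset.setP AB; apply/finset.setP => x.
have := AB x; have := AK x; have := BK x; rewrite !inE.
case: (x \in A) (x \in B) (x \in K) (x \in c) => [] [] [] [] //= hB hA _.
all: by [have := hA isT | have := hB isT].
Qed.

Lemma card_cylinder_layer K c k :
  (#|[set b in cylinder K c | #|b| == k]| <= 'C(#|~: K|, k - #|c :&: K|))%N.
Proof.
set S := [set b in _ | _].
have inj : {in S &, injective (fun b => b :\: K)}.
  move=> a b; rewrite !inE => /andP[/eqP aK _] /andP[/eqP bK _] ab.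
  by rewrite -(setID a K) aK -bK ab setID.
rewrite -(card_in_imset inj) -cards_draws.
apply: subset_leq_card; apply/fintype.subsetP => _ /imsetP[b + ->].
rewrite !inE => /andP[/eqP bK /eqP <-].
by rewrite subsetDr -bK -(cardsID K b) addKn eqxx.
Qed.

(* At most [w] values of [#|b|] fall in the window, and each is taken on at most
   a fraction [1 / sqrt #|~: K|] of the cylinder. *)
Lemma card_window K c (x r beta : R) (w : nat) : 2 * r < w%:R -> 0 <= beta ->
    (0 < #|~: K|)%N -> w%:R ^+ 2 <= beta ^+ 2 * #|~: K|%:R ->
  #|[set b in cylinder K c | `|#|b|%:R - x| <= r]|%:R
    <= beta * #|cylinder K c|%:R.
Proof.
set W := [set b in _ | _]; set M := #|~: K| => rw beta0 M0 wM.
have [W0|W_neq0] := eqVneq W finset.set0.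
  by rewrite W0 cards0 mulr_ge0.
have [b1 b1W] : exists b, b \in W by apply/finset.set0Pn.
(* Counted from the size of a smallest member [b0], a window of width 2r < w leaves at most [w]
   sizes. *)
case: (@arg_minnP _ b1 (mem W) (fun b => #|b|) b1W) => b0 b0W b0min.
have {}b0W : b0 \in W by [].
have := b0W; rewrite inE => /andP[_ xb0].
have w_gt0 : (0 < w)%N.
  have : 0 <= r by apply: le_trans xb0.
  by rewrite -(ltr_nat R); lra.
(* Squared and multiplied by [M], this is the product of C(M, k)^2 M <= 4^M and the hypothesis on
   [w]. *)
have layer k : 'C(M, k)%:R <= beta * 2 ^+ M / w%:R :> R.
  rewrite ler_pdivlMr ?ltr0n // -ler_sqr ?nnegrE ?mulr_ge0 ?exprn_ge0 //.
  have CM : 'C(M, k)%:R ^+ 2 * M%:R <= (2 ^+ M) ^+ 2 :> R.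
    have -> : (2 ^+ M) ^+ 2 = (4 ^ M)%:R :> R.
      by rewrite natrX -exprM mulnC exprM; congr (_ ^+ _); ring.
    by rewrite -natrX -natrM ler_nat bin_sqr_le.
  rewrite -(@ler_pM2r _ M%:R) ?ltr0n //.
  have := ler_pM _ _ CM wM; rewrite !(mulr_ge0, exprn_ge0, ler0n) // => /(_ isT isT).
  by apply: etrans; congr (_ <= _); ring.
have W_le : (#|W| <= \sum_(i < w) 'C(M, #|b0| + i - #|c :&: K|))%N.
  have sub : W \subset (\bigcup_(i < w) [set b in cylinder K c | #|b| == (#|b0| + i)%N])%SET.
    apply/fintype.subsetP => b bW; have b0b := b0min _ bW.
    have lt_w : (#|b| - #|b0| < w)%N.
      rewrite -(ltr_nat R) natrB //; apply: le_lt_trans rw.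
      move: bW xb0; rewrite inE => /andP[_ +].
      by rewrite !ler_norml => /andP[? ?] /andP[? ?]; lra.
    apply/finset.bigcupP; exists (Ordinal lt_w) => //=; rewrite inE subnKC // eqxx andbT.
    by move: bW; rewrite inE => /andP[].
  apply: leq_trans (subset_leq_card sub) _.
  apply: leq_trans
    (_ : \sum_(i < w) #|[set b in cylinder K c | #|b| == (#|b0| + i)%N]| <= _)%N.
    elim/big_rec2: _ => [|i y s _ ih]; first by rewrite cards0.
    by apply: leq_trans (leq_card_setU _ _) _; rewrite leq_add2l.
  by apply: leq_sum => i _; apply: card_cylinder_layer.
apply: le_trans (_ : beta * 2 ^+ M <= _); last first.
  by rewrite ler_wpM2l // -natrX ler_nat card_cylinder.
apply: (@le_trans _ _ (\sum_(i < w) 'C(M, #|b0| + i - #|c :&: K|)%:R)).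
  by rewrite -natr_sum ler_nat.
apply: le_trans (ler_sum _ (fun i _ => layer _)) _.
by rewrite sumr_const card_ord -[X in X <= _]mulr_natr divfK // pnatr_eq0 -lt0n.
Qed.

End AntiConcentration.

(** * The hard graphs *)

Section FinTypeDigraph.
Variables (T : finType) (o i : T -> seq T).
Hypotheses (o_uniq : forall x, uniq (o x)) (i_uniq : forall x, uniq (i x)).
Hypothesis mem_i : forall x y, (x \in i y) = (y \in o x).
Hypothesis o_neq0 : forall x, o x != [::].

(** Labels are given by [enum_rank], so they depend on [T] alone and not on the edges; edge
    positions are kept. *)
Definition relabel (f : T -> seq T) (v : 'I_#|T|) : seq 'I_#|T| :=
  map enum_rank (f (enum_val v)).

Lemma mem_relabel f u v : (u \in relabel f v) = (enum_val u \in f (enum_val v)).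
Proof. by rewrite -{1}(enum_valK u) (mem_map enum_rank_inj). Qed.

Lemma relabel_uniq f v : (forall x, uniq (f x)) -> uniq (relabel f v).
Proof. by move=> f_uniq; rewrite (map_inj_uniq enum_rank_inj). Qed.

Lemma size_relabel f x : size (relabel f (enum_rank x)) = size (f x).
Proof. by rewrite size_map enum_rankK. Qed.

Definition fin_digraph : digraph.
Proof.
refine (@Digraph #|T| (relabel o) (relabel i) _ _ _ _).
- by move=> v; apply: relabel_uniq.
- by move=> v; apply: relabel_uniq.
- by move=> u v; rewrite !mem_relabel mem_i.
- by move=> v; rewrite -size_eq0 size_map size_eq0.
Defined.

Definition node_of (x : T) : 'I_(nnodes fin_digraph) := enum_rank x.

Lemma nedges_fin_digraph : nedges fin_digraph = (\sum_x size (o x))%N.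
Proof.
rewrite /nedges (reindex_onto enum_rank enum_val) /=; last by move=> v _; rewrite enum_valK.
by apply: eq_big => x; rewrite ?enum_rankK ?eqxx // => _; rewrite /outdeg size_relabel.
Qed.

Section Walk.
Variables (R : realType) (alpha : R).

Definition walk (s : T) (k : nat) (x : T) : R := walk_at alpha (node_of s) k (node_of x).

Lemma walk0 s x : walk s 0 x = (x == s)%:R.
Proof. by rewrite /walk /= (inj_eq enum_rank_inj). Qed.

Lemma walkS s k x :
  walk s k.+1 x = \sum_(y <- i x) walk s k y * ((1 - alpha) / (size (o y))%:R).
Proof.
rewrite big_uniq // /walk /= (reindex_onto enum_rank enum_val) /=; last first.
  by move=> v _; rewrite enum_valK.
apply: eq_big => y; first by rewrite mem_relabel !enum_rankK eqxx andbT mem_i.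
by move=> _; rewrite /outdeg size_relabel.
Qed.

End Walk.
End FinTypeDigraph.

(** Walks from [Src] descend one layer per move and then loop at a sink. They enter [Up] in the copy
    [false], so the boolean carried from [Low] on is the bit of the edge taken from [Up] to
    [Low]. *)
Inductive node (D : nat) : predArgType :=
  | Src
  | Up of bool & 'I_D
  | Low of bool & 'I_D
  | Sink of bool.
Arguments Src {D}.
Arguments Sink {D}.

Definition node_code D (x : node D) : unit + bool * 'I_D + (bool * 'I_D + bool) :=
  match x with
  | Src => inl (inl tt)
  | Up c i => inl (inr (c, i))
  | Low c j => inr (inl (c, j))
  | Sink c => inr (inr c)
  end.

Definition node_decode D (y : unit + bool * 'I_D + (bool * 'I_D + bool)) : node D :=
  match y with
  | inl (inl _) => Src
  | inl (inr (c, i)) => Up c i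
  | inr (inl (c, j)) => Low c j
  | inr (inr c) => Sink c
  end.

Lemma node_codeK D : cancel (@node_code D) (@node_decode D).
Proof. by case. Qed.

HB.instance Definition _ D := Finite.copy (node D) (can_type (@node_codeK D)).

Lemma node_decodeK D : cancel (@node_decode D) (@node_code D).
Proof. by case=> [[[]|[]]|[[]|]]. Qed.

Lemma big_node (S : Type) (idx : S) (op : Monoid.com_law idx) D (F : node D -> S) :
  \big[op/idx]_x F x =
  op (op (F Src) (\big[op/idx]_c \big[op/idx]_i F (Up c i)))
     (op (\big[op/idx]_c \big[op/idx]_j F (Low c j)) (\big[op/idx]_c F (Sink c))).
Proof.
rewrite (reindex (@node_decode D)); last first.
  by apply: onW_bij; exists (@node_code D); [apply: node_decodeK | apply: node_codeK].
rewrite !big_sumType /= !pair_bigA /= (big_pred1 tt) /=; last by case.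
congr (op (op _ _) (op _ _)); apply: eq_bigr => -[] //.
Qed.

Lemma card_node D : #|node D| = (4 * D + 3)%N.
Proof.
by rewrite -sum1_card big_node /= !big_bool /= !sum_nat_const !card_ord; lia.
Qed.

(** * The graph of a bit matrix *)

Section Gadget.
Variables (D : nat) (D_gt0 : (0 < D)%N).
Implicit Types (b : {set 'I_D * 'I_D}) (x y : node D).

(* Bit (i, j) twists the pair of edges Up c i -> Low c j (c = false, true) into
   Up c i -> Low (~~ c) j.  The nodes [Up true i] are unreachable from [Src]:
   they only make the in-degrees independent of [b]. *)
Definition gouts b x : seq (node D) :=
  match x with
  | Src => [seq Up false i | i <- enum 'I_D]
  | Up c i => [seq Low (c (+) ((i, j) \in b)) j | j <- enum 'I_D]
  | Low c _ => [:: Sink c]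
  | Sink c => [:: Sink c]
  end.

(** Xor is an involution, so the in-neighbour of [Low c j] in row [i] is again decided by the single
    bit (i, j). *)
Definition gins b x : seq (node D) :=
  match x with
  | Src => [::]
  | Up c _ => if c then [::] else [:: Src]
  | Low c j => [seq Up (c (+) ((i, j) \in b)) i | i <- enum 'I_D]
  | Sink c => Sink c :: [seq Low c j | j <- enum 'I_D]
  end.

Lemma gouts_uniq b x : uniq (gouts b x).
Proof.
by case: x => [|c i|c j|c] //=; rewrite map_inj_uniq ?enum_uniq // => ? ? [].
Qed.

Lemma gins_uniq b x : uniq (gins b x).
Proof.
case: x => [|[] i|c j|c] //=; first by rewrite map_inj_uniq ?enum_uniq // => ? ? [].
rewrite map_inj_uniq ?enum_uniq => [|? ? []//]; rewrite andbT.
by apply/mapP => -[].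
Qed.

Lemma mem_gins b x y : (x \in gins b y) = (y \in gouts b x).
Proof.
have mapF (f : 'I_D -> node D) z : (forall i, f i <> z) ->
    (z \in [seq f i | i <- enum 'I_D]) = false.
  by move=> fz; apply/negbTE/mapP => -[i _ /esym/fz].
have mapE (C : bool -> 'I_D -> node D) (g : 'I_D -> bool) c i :
    (forall c1 c2 i1 i2, C c1 i1 = C c2 i2 -> c1 = c2 /\ i1 = i2) ->
    (C c i \in [seq C (g i) i | i <- enum 'I_D]) = (c == g i).
  move=> C_inj; apply/mapP/eqP => [[i' _ /C_inj[-> ->]] // | ->].
  by exists i; rewrite ?mem_enum.
case: y x => [|d j|d j|d] [|c i|c i|c] /=.
all: rewrite ?inE ?(mapE _ (fun _ => false)) ?(mapE Low (fun _ => d)) ?mapE ?mapF //.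
all: try by move=> ? ? ? ? [-> ->].
all: try by case: d.
  by case: c d (_ \in b) => [] [] [].
by rewrite orbF eq_sym.
Qed.

(** Degrees are functions of the node alone, so degree queries reveal nothing about [b]. *)
Definition gouts_size x : nat :=
  match x with Src | Up _ _ => D | Low _ _ | Sink _ => 1 end.

Definition gins_size x : nat :=
  match x with Src => 0 | Up c _ => ~~ c | Low _ _ => D | Sink _ => D.+1 end.

Lemma size_gouts b x : size (gouts b x) = gouts_size x.
Proof. by case: x => [|c i|c j|c] //=; rewrite size_map size_enum_ord. Qed.

Lemma size_gins b x : size (gins b x) = gins_size x.
Proof. by case: x => [|[] i|c j|c] //=; rewrite size_map size_enum_ord. Qed.

Lemma gouts_neq0 b x : gouts b x != [::].
Proof.
by rewrite -size_eq0 size_gouts -lt0n; case: x.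
Qed.

Definition gadget b : digraph :=
  fin_digraph (gouts_uniq b) (gins_uniq b) (mem_gins b) (gouts_neq0 b).

Definition gnode b x : 'I_(nnodes (gadget b)) := enum_rank x.

Lemma nnodes_gadget b : nnodes (gadget b) = (4 * D + 3)%N.
Proof. exact: card_node. Qed.

Lemma nedges_gadget b : nedges (gadget b) = (2 * D ^ 2 + 3 * D + 2)%N.
Proof.
rewrite nedges_fin_digraph (eq_bigr _ (fun x _ => size_gouts b x)) big_node /= !big_bool /=.
by rewrite !sum_nat_const !card_ord; lia.
Qed.

(** * PageRank of the sink *)

Section GadgetPPR.
Variables (R : realType) (alpha : R) (b : {set 'I_D * 'I_D}).
Hypothesis alpha01 : 0 < alpha < 1.
Let w := walk (gouts_uniq b) (gins_uniq b) (mem_gins b) (gouts_neq0 b) alpha Src.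

Lemma walk_Src k : w k Src = (k == 0%N)%:R.
Proof. by case: k => [|k]; rewrite /w ?walk0 // walkS big_nil. Qed.

Lemma walk_Up k c i : w k (Up c i) = (~~ c && (k == 1%N))%:R * ((1 - alpha) / D%:R).
Proof.
case: k => [|k]; first by rewrite /w walk0 andbF mul0r.
rewrite /w walkS; case: c => /=; first by rewrite big_nil mul0r.
by rewrite big_seq1 -/(w k Src) walk_Src size_map size_enum_ord.
Qed.

(** The in-neighbour of [Low true j] in row [i] is [Up false i], hence reachable, exactly when the
    bit (i, j) is set. *)
Lemma walk_Low k j : w k (Low true j) =
  (k == 2)%:R * (\sum_(i < D) ((i, j) \in b)%:R) * ((1 - alpha) / D%:R) ^+ 2.
Proof.
case: k => [|k]; first by rewrite /w walk0 !mul0r.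
rewrite /w walkS big_map big_enum /= mulr_sumr mulr_suml; apply: eq_bigr => i _.
by rewrite -/(w k _) walk_Up size_map size_enum_ord negbK -mulnb natrM; ring.
Qed.

(** The mass (1 - alpha)^3 |b| / D^2 arrives at move 3; afterwards only the loop feeds the sink,
    with a factor 1 - alpha per move. *)
Lemma walk_Sink k : w k (Sink true) =
  (2 < k)%:R * (1 - alpha) ^+ k * (#|b|%:R / (D ^ 2)%:R).
Proof.
elim: k => [|k IHk]; first by rewrite /w walk0 !mul0r.
rewrite /w walkS big_cons big_map big_enum /= -/(w k _) IHk.
have -> : \sum_(j < D) w k (Low true j) * ((1 - alpha) / 1%:R) =
    (k == 2)%:R * #|b|%:R * ((1 - alpha) / D%:R) ^+ 2 * (1 - alpha).
  have -> : #|b|%:R = \sum_(j < D) \sum_(i < D) ((i, j) \in b)%:R :> R.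
    rewrite exchange_big pair_bigA /= -natr_sum -sum1_card big_mkcond /=.
    by congr _%:R; apply: eq_bigr => -[i j] _; case: (_ \in _).
  rewrite mulr_sumr !mulr_suml; apply: eq_bigr => j _.
  by rewrite walk_Low divr1.
have D_neq0 : D%:R != 0 :> R by rewrite pnatr_eq0 -lt0n.
by case: k {IHk} => [|[|[|k]]] /=; rewrite ?natrX ?exprS; field.
Qed.

Lemma ppr_gadget : ppr alpha (gnode b Src) (gnode b (Sink true)) =
  (1 - alpha) ^+ 3 * (#|b|%:R / (D ^ 2)%:R).
Proof.
case/andP: alpha01 => alpha_gt0 alpha_lt1.
set V := #|b|%:R / _.
pose u k := (2 < k)%:R * (1 - alpha) ^+ k * V * alpha.
rewrite /ppr (_ : (fun k => _) = u); last first.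
  by apply/funext => k; rewrite /u -walk_Sink.
set c := (1 - alpha) ^+ 3 * V.
(* The terms of index below 3 vanish; shifting by 3 leaves a geometric sum. *)
have sumE n : series u (n + 3)%N = c * (1 - (1 - alpha) ^+ n).
  rewrite /series /c /=; elim: n => [|n IHn].
    by rewrite !big_nat_recr //= big_geq // /u /=; ring.
  by rewrite addSn big_nat_recr //= IHn /u addn3 /= !exprS; ring.
have : (fun n => c * (1 - (1 - alpha) ^+ n)) @ \oo --> c * (1 - 0).
  apply: cvgMl_tmp; apply: cvgB; first exact: cvg_cst.
  by apply: cvg_expr; rewrite ger0_norm; lra.
rewrite subr0 mulr1 -(funext sumE) => h.
by apply: cvg_lim => //; rewrite -(cvg_shiftn 3).
Qed.

End GadgetPPR.
End Gadget.

(** * Queries reveal at most one bit *)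

Section Runs.
Variables (R : realType) (alpha eps : R) (G : digraph) (s : 'I_(nnodes G)).
Variable st : history -> action R.

Lemma mean_ge0 l (f : option nat -> R) : (forall a, 0 <= f a) -> 0 <= mean l f.
Proof. by move=> f0; rewrite divr_ge0 // sumr_ge0. Qed.

Lemma ler_mean l (f g : option nat -> R) : (forall a, f a <= g a) -> mean l f <= mean l g.
Proof. by move=> fg; rewrite ler_wpM2r // ler_sum. Qed.

Lemma mean_le1 l (f : option nat -> R) : (forall a, f a <= 1) -> mean l f <= 1.
Proof.
move=> f1; apply: (@le_trans _ _ (mean l (fun=> 1))); first exact: ler_mean.
rewrite /mean big_const_seq count_predT iter_addr_0.
by case: l => [|a l] /=; rewrite ?mul0r // divff // pnatr_eq0.
Qed.

Lemma success_within_ge0 k h : 0 <= success_within alpha eps s st k h.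
Proof.
by elim: k h => [|k IHk] h /=; case: (st h) => // q; apply: mean_ge0 => a.
Qed.

Lemma success_within_le1 k h : success_within alpha eps s st k h <= 1.
Proof.
elim: k h => [|k IHk] h /=; case: (st h) => [q|est]; rewrite ?lern1 ?leq_b1 //.
by apply: mean_le1 => a.
Qed.

Lemma success_within_leS k h :
  success_within alpha eps s st k h <= success_within alpha eps s st k.+1 h.
Proof.
elim: k h => [|k IHk] h; rewrite [leRHS]/= [leLHS]/=; case: (st h) => // q.
  by apply: mean_ge0 => a; exact: (success_within_ge0 0).
by apply: ler_mean => a.
Qed.

Lemma mean_queries_ge0 k h : 0 <= mean_queries_upto s st k h.
Proof.
elim: k h => [|k IHk] h /=; case: (st h) => // q.
by rewrite addr_ge0 //; apply: mean_ge0 => a.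
Qed.

Lemma mean_queries_leS k h :
  mean_queries_upto s st k h <= mean_queries_upto s st k.+1 h.
Proof.
elim: k h => [|k IHk] h; rewrite [leRHS]/= [leLHS]/=; case: (st h) => // q.
  by rewrite addr_ge0 //; apply: mean_ge0 => a; exact: (mean_queries_ge0 0).
by rewrite lerD2l; apply: ler_mean => a.
Qed.

End Runs.

Lemma sum_mean (R : realType) (I : finType) (P : pred I) l (f : I -> option nat -> R) :
  \sum_(i | P i) mean l (f i) = mean l (fun a => \sum_(i | P i) f i a).
Proof. by rewrite /mean exchange_big mulr_suml. Qed.

Lemma mean_affine (R : realType) l (f : option nat -> R) u v : (0 < size l)%N ->
  mean l (fun a => u + f a * v) = u + mean l f * v.
Proof.
move=> l_gt0; have l_neq0 : (size l)%:R != 0 :> R by rewrite pnatr_eq0 -lt0n.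
rewrite /mean big_split /= mulrDl big_const_seq count_predT iter_addr_0.
by rewrite -[u *+ _]mulr_natr mulfK // -mulr_suml mulrAC.
Qed.

Lemma size_answers_gt0 (G : digraph) (s : 'I_(nnodes G)) h q : (0 < size (answers s h q))%N.
Proof.
by case: q => //=; rewrite size_map size_enum_ord; apply: leq_ltn_trans (ltn_ord s).
Qed.

Section CylinderSplit.
Variables (T : finType).
Implicit Types (K b c : {set T}).

Lemma mem_cylinder K c b e : b \in cylinder K c -> e \in K -> (e \in b) = (e \in c).
Proof. by rewrite inE => /eqP/finset.setP/(_ e); rewrite !inE => + eK; rewrite eK !andbT. Qed.

(** The two outcomes of reading a new bit [e]: [e |: c] sets it, [c :\ e] clears it. *)
Lemma sum_cylinder_split (R : realType) K c e (F : {set T} -> R) : e \notin K ->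
  \sum_(b in cylinder K c) F b =
    \sum_(b in cylinder (e |: K) (e |: c)) F b + \sum_(b in cylinder (e |: K) (c :\ e)) F b.
Proof.
move=> eK; rewrite (bigID (fun b : {set T} => e \in b)) /=.
have memE (b c' : {set T}) : (b \in cylinder (e |: K) c') =
    (b :&: K == c' :&: K) && ((e \in b) == (e \in c')).
  rewrite inE; apply/eqP/andP => [/finset.setP bc | [/eqP/finset.setP bc /eqP ebc]].
    split; last by have := bc e; rewrite !inE eqxx !andbT => ->.
    apply/eqP/finset.setP => y; have := bc y; rewrite !inE.
    by case: (y \in K); rewrite ?orbT ?andbF.
  apply/finset.setP => y; have := bc y; rewrite !inE.
  by case: eqP => [->|_] //=; rewrite ebc.
have cK c' : (c' :\ e) :&: K = c' :&: K.
  apply/finset.setP => y; rewrite !inE; case: eqP => //= ->.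
  by rewrite (negbTE eK) andbF.
have cK' : (e |: c) :&: K = c :&: K.
  apply/finset.setP => y; rewrite !inE; case: eqP => //= ->.
  by rewrite (negbTE eK) andbF.
congr (_ + _); apply: eq_bigl => b; rewrite memE ?cK ?cK' !inE ?eqxx /=.
  by case: (e \in b).
by case: (e \in b).
Qed.

End CylinderSplit.

(** * Success probability against number of queries *)

Section LowerBound.
Variables (D : nat) (D_gt0 : (0 < D)%N) (R : realType) (alpha eps : R).
Implicit Types (b c K : {set 'I_D * 'I_D}).

Let src b := gnode D_gt0 b Src.

(** The entry [e] is chosen before the inputs. Out of range the answer is [None] for every input,
    and the default [e0] serves. *)
Lemma onth_enum_local (S : Type) (f : {set 'I_D * 'I_D} -> 'I_D -> S) i :
    (forall j, exists e, forall b c, (e \in b) = (e \in c) -> f b j = f c j) ->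
  exists e, forall b c, (e \in b) = (e \in c) ->
    onth [seq f b j | j <- enum 'I_D] i = onth [seq f c j | j <- enum 'I_D] i.
Proof.
pose e0 := (Ordinal D_gt0, Ordinal D_gt0).
move=> f_local; case enum_i: (onth (enum 'I_D) i) => [j|].
  have [e fe] := f_local j; exists e => b c /fe fbc.
  by rewrite (onth_map _ _ (f b)) (onth_map _ _ (f c)) enum_i /= fbc.
by exists e0 => b c _; rewrite (onth_map _ _ (f b)) (onth_map _ _ (f c)) enum_i.
Qed.

Lemma onth_gins_local x i : exists e, forall b c, (e \in b) = (e \in c) ->
  onth (gins b x) i = onth (gins c x) i.
Proof.
pose e0 := (Ordinal D_gt0, Ordinal D_gt0).
case: x => [|c j|d j|c] /=; try by exists e0.
by apply: onth_enum_local => k; exists (k, j) => b c ->.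
Qed.

Lemma onth_gouts_local x i : exists e, forall b c, (e \in b) = (e \in c) ->
  onth (gouts b x) i = onth (gouts c x) i.
Proof.
pose e0 := (Ordinal D_gt0, Ordinal D_gt0).
case: x => [|d k|d j|d] /=; try by exists e0.
by apply: onth_enum_local => j; exists (k, j) => b c ->.
Qed.

(** Given the history, labels and covered nodes are the same for all inputs; only an adjacency entry
    can differ, and it depends on one bit. *)
Lemma answers_local h q : exists e, forall b c, (e \in b) = (e \in c) ->
  answers (src b) h q = answers (src c) h q.
Proof.
pose e0 := (Ordinal D_gt0, Ordinal D_gt0).
have ask_local v (f : {set 'I_D * 'I_D} -> 'I_#|node D| -> option nat) :
    (forall u, exists e, forall b c, (e \in b) = (e \in c) -> f b u = f c u) ->
    exists e, forall b c, (e \in b) = (e \in c) ->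
      [:: ask_node (src b) h v (f b)] = [:: ask_node (src c) h v (f c)].
  rewrite /ask_node /= => f_local.
  case: (insub v : option 'I_#|node D|) => [u|] /=; last by exists e0.
  by have [e fe] := f_local u; exists e => b c /fe ->.
case: q => [|v|v|v i|v i] /=.
- by exists e0.
- apply: ask_local => u; exists e0 => b c _.
  by rewrite /indeg !size_map !size_gins.
- apply: ask_local => u; exists e0 => b c _.
  by rewrite /outdeg !size_map !size_gouts.
- apply: ask_local => u; have [e Ee] := onth_gins_local (enum_val u) i.
  by exists e => b c /Ee bc; rewrite /= /relabel !onth_map bc.
- apply: ask_local => u; have [e Ee] := onth_gouts_local (enum_val u) i.
  by exists e => b c /Ee bc; rewrite /= /relabel !onth_map bc.
Qed.

(** Induction on the budget: a query adds at most one entry to [K], raising the bound by 1 / L, and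
    lowers the number of further queries by one, which pays for it. *)
Lemma success_le_queries (L beta : R) (st : history -> action R) : 0 < L ->
    (forall K c est, #|K|%:R < L ->
      \sum_(b in cylinder K c) (accurate alpha eps (src b) est)%:R
        <= beta * #|cylinder K c|%:R) ->
  0 <= beta ->
  forall k h K c,
  \sum_(b in cylinder K c) success_within alpha eps (src b) st k h
    <= \sum_(b in cylinder K c)
         (beta + #|K|%:R / L + mean_queries_upto (src b) st k h / L).
Proof.
move=> L0 acc beta0; elim=> [|k IHk] h K c.
all: have [L_le_K | K_lt_L] := leP L #|K|%:R.
  (* Once [L] entries are known, the success is at most 1 <= |K| / L. *)
  1,3: apply: ler_sum => b _; apply: le_trans (success_within_le1 _ _ _ _ _ _) _.
  1,2: rewrite -[leLHS]addr0 lerD ?divr_ge0 ?mean_queries_ge0 ?(ltW L0) //.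
  1,2: by rewrite -[leLHS]add0r lerD // ler_pdivlMr ?mul1r.
all: case E: (st h) => [q|est].
2, 4: rewrite /= E; apply: le_trans (acc _ _ _ K_lt_L) _.
2, 3: rewrite mulr_natr -sumr_const; apply: ler_sum => b _.
2, 3: by rewrite mul0r addr0 lerDl divr_ge0 // ltW.
  rewrite /= E; apply: ler_sum => b _.
  by rewrite mul0r addr0 addr_ge0 // divr_ge0 // ltW.
have [e answers_e] := answers_local h q.
(* When the decisive bit is in [K'], the whole cylinder shares one list of answers, so the sum over
   inputs moves inside the mean and the induction hypothesis applies to each answer. *)
have revealed K' c' : e \in K' ->
    \sum_(b in cylinder K' c') success_within alpha eps (src b) st k.+1 h
    <= \sum_(b in cylinder K' c')
         (beta + #|K'|%:R / L + (mean_queries_upto (src b) st k.+1 h - 1) / L).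
  move=> eK'; set l := answers (src c') h q.
  have lE b : b \in cylinder K' c' -> answers (src b) h q = l.
    by move=> bK'; apply: answers_e; apply: mem_cylinder bK' eK'.
  have -> : \sum_(b in cylinder K' c') success_within alpha eps (src b) st k.+1 h =
      mean l (fun a => \sum_(b in cylinder K' c')
        success_within alpha eps (src b) st k (rcons h (q, a))).
    by rewrite -sum_mean; apply: eq_bigr => b bK'; rewrite /= E lE.
  apply: le_trans (ler_mean _ (fun a => IHk (rcons h (q, a)) K' c')) _.
  rewrite -sum_mean; apply: ler_sum => b bK'; rewrite [mean_queries_upto _ _ _.+1 _]/= E lE //.
  have l_gt0 : (0 < size l)%N by apply: size_answers_gt0.
  by rewrite mean_affine // (addrC 1) addrK.
have [eK | eK] := boolP (e \in K).
  apply: le_trans (revealed K c eK) _; apply: ler_sum => b _.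
  by rewrite lerD2l ler_pM2r ?invr_gt0 // lerBlDr lerDl.
(* The bit is new: on each half [K] gains one entry, cancelled by the 1 subtracted from the
   queries. *)
rewrite (sum_cylinder_split _ _ eK) [leRHS](sum_cylinder_split _ _ eK).
have eK1 : e \in e |: K by rewrite !inE eqxx.
apply: lerD; apply: le_trans (revealed _ _ eK1) _; apply: ler_sum => b _.
all: by rewrite cardsU1 eK natrD /=; lra.
Qed.

End LowerBound.

(** * Measurability in the coins *)

Section AlgorithmMeasurability.
Variables (R : realType) (A : algorithm R).

(** Queries are countable, which makes halting the complement of a countable union of measurable
    events. Undecodable numbers default to [Jump]. *)
Definition nth_query (n : nat) : query :=
  match odflt (0, 0, 0)%N (unpickle n) with
  | (0, _, _) => Jump
  | (1, v, _) => InDeg v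
  | (2, v, _) => OutDeg v
  | (3, v, i) => AdjIn v i
  | (_, v, i) => AdjOut v i
  end%N.

Lemma nth_query_surj q : exists n, nth_query n = q.
Proof.
pose code : nat * nat * nat := match q with
  | Jump => (0, 0, 0) | InDeg v => (1, v, 0) | OutDeg v => (2, v, 0)
  | AdjIn v i => (3, v, i) | AdjOut v i => (4, v, i) end%N.
by exists (pickle code); rewrite /nth_query pickleK /code /=; case: q {code}.
Qed.

Definition asks s h q : set (coins A) := [set w | strategy w s h = Ask q].

Definition halts s h : set (coins A) := [set w | exists est, strategy w s h = Return est].

Lemma measurable_asks s h q : measurable (asks s h q).
Proof. exact: measurable_ask. Qed.

Lemma haltsE s h : halts s h = ~` \bigcup_n asks s h (nth_query n).
Proof.
apply/seteqP; split => w /=.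
  by move=> [est hE] [n _]; rewrite /asks /= hE.
move=> nask; rewrite /halts /=; case E: (strategy w s h) => [q|est]; last by exists est.
have [n nq] := nth_query_surj q; case: nask; exists n => //.
by rewrite /asks /= nq.
Qed.

Lemma measurable_halts s h : measurable (halts s h).
Proof.
rewrite haltsE; apply: measurableC; apply: bigcupT_measurable => n.
exact: measurable_asks.
Qed.

(** Halting and the individual queries form a countable measurable partition of the coins. *)
Lemma measurable_fun_action s h (F : coins A -> R) :
    (forall q, measurable_fun (asks s h q) F) -> measurable_fun (halts s h) F ->
  measurable_fun setT F.
Proof.
move=> F_ask F_halt; rewrite -(setvU (halts s h)) haltsE setCK -haltsE.
apply/measurable_funU; [|exact: measurable_halts|].
  by apply: bigcupT_measurable => n; apply: measurable_asks.
by split=> //; apply/measurable_fun_bigcup => n; first exact: measurable_asks.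
Qed.

Lemma measurable_mean D l (F : option nat -> coins A -> R) :
  (forall a, measurable_fun D (F a)) -> measurable_fun D (fun w => mean l (F ^~ w)).
Proof. by move=> mF; apply: measurable_funM => //; apply: measurable_sum. Qed.

(** The events [est v <= r] are measurable by assumption; the lower bound comes from removing those
    with r = x - 1 / (n + 1). *)
Lemma measurable_return_between s h v (x y : R) :
  measurable [set w : coins A |
    exists2 est, strategy w s h = Return est & x <= est v <= y].
Proof.
rewrite (_ : [set w | _] =
    [set w | exists2 est, strategy w s h = Return est & est v <= y] `\`
    \bigcup_n [set w | exists2 est, strategy w s h = Return est & est v <= x - n.+1%:R^-1]).
  apply: measurableD; first exact: measurable_return.
  by apply: bigcupT_measurable => n; apply: measurable_return.
apply/seteqP; split => w /=.
  move=> [est hE /andP[xe ey]]; split; first by exists est.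
  move=> [n _ [est']]; rewrite hE => -[<-].
  by rewrite lerBrDr leNgt (le_lt_trans xe) // ltrDl invr_gt0.
move=> [[est hE ey] nx]; exists est => //; rewrite ey andbT leNgt.
apply/negP => ex; apply: nx.
have [n] := ltr_add_invr ex; rewrite -ltrBrDr => /ltW exn.
by exists n => //; exists est.
Qed.

Variables (alpha eps : R) (G : digraph) (s : 'I_(nnodes G)).

Lemma measurable_accurate s' h : measurable [set w : coins A |
  exists2 est, strategy w s' h = Return est & accurate alpha eps s est].
Proof.
rewrite (_ : [set w | _] = \bigcap_(v in [set: 'I_(nnodes G)]) [set w : coins A |
    exists2 est, strategy w s' h = Return est &
      ppr alpha s v - eps <= est (val v) <= ppr alpha s v + eps]).
  by apply: fin_bigcap_measurable => // v _; apply: measurable_return_between.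
apply/seteqP; split => w /=.
  move=> [est hE /forallP est_acc] v _; exists est => //.
  by have := est_acc v; rewrite ler_distl.
move=> acc; have [est hE _] := acc s I; exists est => //.
apply/forallP => v; rewrite ler_distl.
by have [est'] := acc v I; rewrite hE => -[<-].
Qed.

Lemma measurable_success_within s' k h :
  measurable_fun setT (fun w : coins A => success_within alpha eps s (strategy w s') k h).
Proof.
have on_halts j h' : measurable_fun (halts s' h')
    (fun w : coins A => success_within alpha eps s (strategy w s') j h').
  pose Acc := [set w : coins A |
    exists2 est, strategy w s' h' = Return est & accurate alpha eps s est].
  apply: (eq_measurable_fun (\1_Acc : coins A -> R)); last first.
    exact/measurable_indic/measurable_accurate.
  move=> w; rewrite inE => -[est hE]; rewrite indicE.
  have -> : (w \in Acc) = accurate alpha eps s est.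
    apply/idP/idP => [|est_acc]; rewrite inE; last by exists est.
    by move=> [est']; rewrite hE => -[<-].
  by case: j => [|j]; rewrite /= hE.
elim: k h => [|k IHk] h;
  (apply: (@measurable_fun_action s' h) => [q|]; last exact: on_halts).
  apply: (eq_measurable_fun (cst 0 : coins A -> R)); last exact: measurable_cst.
  by move=> w; rewrite inE /asks /= => ->.
apply: (eq_measurable_fun (fun w => mean (answers s h q)
    (fun a => success_within alpha eps s (strategy w s') k (rcons h (q, a))))).
  by move=> w; rewrite inE /asks /= => ->.
by apply: measurable_mean => a; apply: measurable_funTS; apply: IHk.
Qed.

Lemma measurable_mean_queries s' k h :
  measurable_fun setT (fun w : coins A => mean_queries_upto s (strategy w s') k h).
Proof.
have on_halts j h' : measurable_fun (halts s' h')
    (fun w : coins A => mean_queries_upto s (strategy w s') j h').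
  apply: (eq_measurable_fun (cst 0 : coins A -> R)); last exact: measurable_cst.
  by move=> w; rewrite inE => -[est hE]; case: j => [|j]; rewrite /= hE.
elim: k h => [|k IHk] h;
  (apply: (@measurable_fun_action s' h) => [q|]; last exact: on_halts).
  apply: (eq_measurable_fun (cst 0 : coins A -> R)); last exact: measurable_cst.
  by move=> w; rewrite inE /asks /= => ->.
apply: (eq_measurable_fun (fun w => 1 + mean (answers s h q)
    (fun a => mean_queries_upto s (strategy w s') k (rcons h (q, a))))).
  by move=> w; rewrite inE /asks /= => ->.
apply: measurable_funD; first exact: measurable_cst.
by apply: measurable_mean => a; apply: measurable_funTS; apply: IHk.
Qed.

End AlgorithmMeasurability.

(** * Averaging over the hard graphs *)

Section Integration.
Variables (D : nat) (D_gt0 : (0 < D)%N) (R : realType) (alpha eps : R).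
Implicit Types (b c K : {set 'I_D * 'I_D}).

Let src b := gnode D_gt0 b Src.

(** Accuracy at the single node [Sink true] confines [#|b|] to a window, while more than half of the
    entries lie outside [K]. *)
Lemma sum_accurate_cylinder (beta : R) (w : nat) K c est : 0 < alpha < 1 ->
    2 * (eps * (D ^ 2)%:R / (1 - alpha) ^+ 3) < w%:R ->
    0 <= beta -> w%:R ^+ 2 <= beta ^+ 2 * ((D ^ 2)%:R / 2) ->
    #|K|%:R < (D ^ 2)%:R / 2 :> R ->
  \sum_(b in cylinder K c) (accurate alpha eps (src b) est)%:R
    <= beta * #|cylinder K c|%:R.
Proof.
move=> alpha01 w_gt beta0 w_le K_lt.
have gamma_gt0 : 0 < (1 - alpha) ^+ 3 by rewrite exprn_gt0 //; lra.
have N_gt0 : 0 < (D ^ 2)%:R :> R by rewrite ltr0n expn_gt0 D_gt0.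
(* [Sink true] has the same label for every [b], so this centre serves all inputs. *)
pose x := est (val (gnode D_gt0 finset.set0 (Sink true))) * (D ^ 2)%:R / (1 - alpha) ^+ 3.
set r := _ / _ in w_gt.
have unseen : #|~: K|%:R + #|K|%:R = (D ^ 2)%:R :> R.
  by rewrite -natrD addnC cardsC card_prod card_ord expnS expn1.
apply: le_trans (_ : #|[set b in cylinder K c | `|#|b|%:R - x| <= r]|%:R <= _).
  rewrite -sum1_card natr_sum.
  rewrite [leRHS](eq_bigl (fun b => (b \in cylinder K c) && (`|#|b|%:R - x| <= r))).
    rewrite [leRHS]big_mkcondr. apply: ler_sum => b _.
    case: (boolP (accurate _ _ _ _)) => [/forallP acc_b|_]; last by case: ifP.
    move: (acc_b (gnode D_gt0 b (Sink true))); rewrite (ppr_gadget _ _ alpha01) => acc; rewrite ifT //.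
    have -> : #|b|%:R - x = ((1 - alpha) ^+ 3 * (#|b|%:R / (D ^ 2)%:R)
        - est (val (gnode D_gt0 b (Sink true)))) * ((D ^ 2)%:R / (1 - alpha) ^+ 3).
      rewrite /x; field; apply/andP; split; last by rewrite pnatr_eq0 -lt0n.
      by rewrite lt0r_neq0 //; lra.
    rewrite normrM distrC [X in _ * X]ger0_norm; last by rewrite divr_ge0 ?ltW.
    by rewrite /r -[leRHS]mulrA ler_wpM2r // divr_ge0 // ltW.
  by move=> b; rewrite !inE.
apply: (@card_window R _ K c x r beta w w_gt beta0).
  by rewrite -(ltr_nat R); lra.
by apply: le_trans w_le _; rewrite ler_wpM2l ?exprn_ge0 //; lra.
Qed.

Section Average.
Variables (L beta q : R) (A : algorithm R).
Hypotheses (L_gt0 : 0 < L) (beta_ge0 : 0 <= beta).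
Hypothesis few_accurate : forall K c est, #|K|%:R < L ->
  \sum_(b in cylinder K c) (accurate alpha eps (src b) est)%:R
    <= beta * #|cylinder K c|%:R.
Hypothesis succeeds : forall b, (q%:E <= success_prob alpha eps A (src b))%E.

Let St b (w : coins A) k :=
  (success_within alpha eps (src b) (strategy w (val (src b))) k [::])%:E.
Let Qt b (w : coins A) k :=
  (mean_queries_upto (src b) (strategy w (val (src b))) k [::])%:E.

Lemma cvg_St b w : cvgn (St b w).
Proof.
apply: ereal_nondecreasing_is_cvgn; apply/nondecreasing_seqP => k.
by rewrite lee_fin; apply: success_within_leS.
Qed.

Lemma nondecreasing_Qt b w : nondecreasing_seq (Qt b w).
Proof. by apply/nondecreasing_seqP => k; rewrite lee_fin; apply: mean_queries_leS. Qed.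

Lemma cvg_Qt b w : cvgn (Qt b w).
Proof. by apply: ereal_nondecreasing_is_cvgn; apply: nondecreasing_Qt. Qed.

Lemma limn_St_ge0 b w : (0 <= limn (St b w))%E.
Proof.
apply: lime_ge; first exact: cvg_St.
by apply: nearW => k; rewrite lee_fin success_within_ge0.
Qed.

Lemma limn_Qt_ge0 b w : (0 <= limn (Qt b w))%E.
Proof.
apply: lime_ge; first exact: cvg_Qt.
by apply: nearW => k; rewrite lee_fin mean_queries_ge0.
Qed.

Lemma Qt_le_limn b w k : (Qt b w k <= limn (Qt b w))%E.
Proof.
rewrite (cvg_lim _ (ereal_nondecreasing_cvgn (@nondecreasing_Qt b w))) //.
by apply: ereal_sup_ubound; exists k.
Qed.

Lemma measurable_limn_St b : measurable_fun setT (fun w : coins A => limn (St b w)).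
Proof.
apply: (emeasurable_fun_cvg (fun k w => St b w k)) => [k|w _]; last exact: cvg_St.
by apply/measurable_EFinP; apply: measurable_success_within.
Qed.

Lemma measurable_limn_Qt b : measurable_fun setT (fun w : coins A => limn (Qt b w)).
Proof.
apply: (emeasurable_fun_cvg (fun k w => Qt b w k)) => [k|w _]; last exact: cvg_Qt.
by apply/measurable_EFinP; apply: measurable_mean_queries.
Qed.

(** The bound of [success_le_queries] with nothing known, where the cylinder holds every input, in
    the limit of the budget. *)
Lemma sum_limn_le w :
  (\sum_b limn (St b w) <= \sum_b (beta%:E + L^-1%:E * limn (Qt b w)))%E.
Proof.
have cvg_sum : (\sum_b St b w k @[k --> \oo] --> \sum_b limn (St b w))%E.
  apply: cvg_nnesum => b _; last exact: cvg_St.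
  by apply: nearW => k; rewrite lee_fin success_within_ge0.
apply: cvge_le cvg_sum; apply: nearW => k.
apply: (@le_trans _ _ (\sum_b (beta%:E + L^-1%:E * Qt b w k))%E); last first.
  apply: lee_sum => b _; apply: leeD2l; apply: lee_wpmul2l; last exact: Qt_le_limn.
  by rewrite lee_fin invr_ge0 ltW.
(* The source has the same label for every [b], so one strategy runs on all inputs. *)
have := success_le_queries (strategy w (val (src finset.set0))) L_gt0 few_accurate
  beta_ge0 k [::] finset.set0 finset.set0.
have allE b : (b \in cylinder finset.set0 finset.set0) = true.
  by rewrite inE !finset.setI0 eqxx.
rewrite !(eq_bigl _ _ allE) cards0 mul0r => h.
move: h; rewrite -lee_fin -!sumEFin => h; apply: le_trans h _.
by apply: lee_sum => b _; rewrite addr0 EFinD EFinM muleC.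
Qed.

(** Otherwise, integrating [sum_limn_le] over the coins bounds the total success by a sum whose
    terms beta + E_b / L are all below [q], where E_b is the expected number of queries on [b]. *)
Lemma exists_many_queries :
  exists b, (((q - beta) * L)%:E <= expected_queries A (src b))%E.
Proof.
apply: contrapT => /forallNP few.
have EQ_lt b : (expected_queries A (src b) < ((q - beta) * L)%:E)%E.
  by rewrite ltNge; apply/negP/few.
have EQ_ge0 b : (0 <= expected_queries A (src b))%E.
  by apply: integral_ge0 => w _; apply: limn_Qt_ge0.
have EQ_fin b : expected_queries A (src b) \is a fin_num.
  by rewrite ge0_fin_numE // (lt_trans (EQ_lt b)) // ltry.
have : (\sum_b success_prob alpha eps A (src b) <=
        \sum_b (beta%:E + L^-1%:E * expected_queries A (src b)))%E.
  rewrite -(ge0_integral_sum (coins_law A) measurableT measurable_limn_St); last first.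
    by move=> b w _; apply: limn_St_ge0.
  have term_ge0 b w : (0 <= L^-1%:E * limn (Qt b w))%E.
    by apply: mule_ge0; [rewrite lee_fin invr_ge0 ltW | exact: limn_Qt_ge0].
  have term_meas b : measurable_fun setT (fun w : coins A => L^-1%:E * limn (Qt b w))%E.
    by apply: measurable_funeM; apply: measurable_limn_Qt.
  have sum_meas b :
      measurable_fun setT (fun w : coins A => beta%:E + L^-1%:E * limn (Qt b w))%E.
    by apply: emeasurable_funD; [exact: measurable_cst | exact: term_meas].
  have -> : (\sum_b (beta%:E + L^-1%:E * expected_queries A (src b)) =
      \int[coins_law A]_w \sum_b (beta%:E + L^-1%:E * limn (Qt b w)))%E.
    rewrite (ge0_integral_sum _ measurableT sum_meas); last first.
      by move=> b w _; rewrite adde_ge0 ?lee_fin.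
    apply: eq_bigr => b _; rewrite ge0_integralD //.
    rewrite (integral_cst _ measurableT) [X in (beta%:E * X)%E](_ : _ = 1%E) ?mule1;
      last first.
      exact: (probability_setT (coins_law A)).
    rewrite ge0_integralZl //.
    - exact: measurable_limn_Qt.
    - by move=> w _; apply: limn_Qt_ge0.
    - by rewrite lee_fin invr_ge0 ltW.
  apply: ge0_le_integral => //.
  - by move=> w _; apply: sume_ge0 => b _; apply: limn_St_ge0.
  - by apply: emeasurable_sum => b; apply: measurable_limn_St.
  - exact: emeasurable_sum.
  - by move=> w _; apply: sum_limn_le.
apply/negP; rewrite -ltNge.
apply: (@lt_le_trans _ _ (\sum_(b : {set 'I_D * 'I_D}) q%:E)%E); last exact: lee_sum.
have EQE b : expected_queries A (src b) = (fine (expected_queries A (src b)))%:E.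
  by rewrite fineK.
under eq_bigr => b _ do rewrite EQE.
rewrite sumEFin sumEFin lte_fin ltr_sum //.
  by apply/hasP; exists finset.set0; rewrite ?mem_index_enum.
move=> b _; have := EQ_lt b; rewrite EQE lte_fin => EQb.
by rewrite -ltrBrDl mulrC ltr_pdivrMr.
Qed.

End Average.
End Integration.

(** * Choice of the parameters *)

Lemma gadget_of_size (R : realType) (D n m : nat) (D_gt0 : (0 < D)%N) (k : R) b :
    (D ^ 2 <= m)%N -> m%:R <= k * n%:R ^+ 2 -> 0 <= k ->
  of_size (7 * (k + 1)) n m (gadget D_gt0 b).
Proof.
move=> D_le m_le k0; have D1 : 1 <= D%:R :> R by rewrite ler1n.
have D_sqr : D%:R ^+ 2 <= m%:R :> R by rewrite -natrX ler_nat.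
have n0 : 0 <= n%:R :> R by [].
split; rewrite ?nnodes_gadget ?nedges_gadget !natrD ?natrX.
  (* Here D^2 <= m <= k n^2 <= ((k + 1) n)^2. *)
  have D_le_n : D%:R <= (k + 1) * n%:R.
    rewrite -ler_sqr ?nnegrE ?mulr_ge0 ?addr_ge0 //.
    have := mulr_ge0 (exprn_ge0 2 k0) (exprn_ge0 2 n0); have := mulr_ge0 k0 (exprn_ge0 2 n0).
    by have := exprn_ge0 2 n0; rewrite exprMn; nra.
  by nra.
apply: (@le_trans _ _ (7 * m%:R)); first by nra.
by have : 0 <= m%:R :> R by []; nra.
Qed.

(** For eps >= 1/2 the constant estimate 1/2 is accurate without any query, hence the maximum with 1
    in the bound. *)
Theorem theorem1p8 (R : realType) (alpha p : R) (m : nat -> nat)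
    (alpha01 : 0 < alpha < 1) (p01 : 0 < p < 1)
    (m_Omega : (fun n => (m n)%:R : R^o) \is 'Omega_\oo (fun n => n%:R : R^o))
    (m_O : (fun n => (m n)%:R : R^o) =O_\oo (fun n => n%:R ^+ 2 : R^o)) :
  exists C c : R, [/\ 0 < C, 0 < c &
    forall eps : nat -> R, (forall n, 0 < eps n < 1) ->
    \forall n \near \oo, forall A : algorithm R,
      (forall (G : digraph) (s : 'I_(nnodes G)), of_size C n (m n) G ->
         ((1 - p)%:E <= success_prob alpha (eps n) A s)%E) ->
      exists (U : digraph) (s : 'I_(nnodes U)),
        of_size C n (m n) U /\
        ((c * Num.min (m n)%:R (1 / eps n ^+ 2))%:E
           <= maxe 1%E (expected_queries A s))%E].
Proof.
pose q := 1 - p; pose gamma := (1 - alpha) ^+ 3; pose kappa := (q * gamma / 12) ^+ 2.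
have q_gt0 : 0 < q by rewrite /q; lra.
have q_le1 : q <= 1 by rewrite /q; lra.
have gamma_gt0 : 0 < gamma by rewrite exprn_gt0 //; lra.
have gamma_le1 : gamma <= 1 by rewrite exprn_ile1 //; lra.
have qg_gt0 : 0 < q * gamma / 12 by apply: divr_gt0 => //; apply: mulr_gt0.
have qg_le1 : q * gamma / 12 <= 1 by rewrite ler_pdivrMr //; nra.
have kappa_gt0 : 0 < kappa by rewrite exprn_gt0.
have kappa_le1 : kappa <= 1 by rewrite exprn_ile1 // ltW.
move: m_Omega; rewrite eqOmegaO => /eqO_exP[k1 k1_gt0 m_ge].
move/eqO_exP: m_O => [k2 k2_gt0 m_le].
(* The first constant is that of [gadget_of_size]; 49 is the square of the bound 7 on x q when [x]
   is small. *)
exists (7 * (k2 + 1)), (kappa * q ^+ 2 / 49); split.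
- by apply: mulr_gt0 => //; apply: addr_gt0.
- by apply: divr_gt0 => //; apply: mulr_gt0 => //; apply: exprn_gt0.
move=> eps eps01; near=> n => A A_succeeds.
have /andP[e_gt0 _] := eps01 n; set e := eps n in e_gt0 A_succeeds *.
have n_gt0 : (0 < n)%N by near: n; exists 1%N.
have m_gt0 : (0 < m n)%N.
  have : `|n%:R| <= k1 * `|(m n)%:R| :> R by near: n.
  by case: (m n) => //; rewrite normr0 mulr0 normr_le0 pnatr_eq0 eqn0Ngt n_gt0.
have m_le_n2 : (m n)%:R <= k2 * n%:R ^+ 2 :> R.
  have : `|(m n)%:R| <= k2 * `|n%:R ^+ 2| :> R by near: n.
  by rewrite !ger0_norm ?exprn_ge0.
set M := (m n)%:R : R; have M_ge0 : 0 <= M by [].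
(* The target for [D]: the first term keeps D^2 <= m, the second keeps the window below q D / 6. *)
pose x := Num.min (Num.sqrt M) (q * gamma / 12 / e).
have x_ge0 : 0 <= x by rewrite le_min sqrtr_ge0 divr_ge0 // ltW.
have x_le : x <= q * gamma / 12 / e by rewrite ge_min lexx orbT.
have x_sqr : kappa * Num.min M (1 / e ^+ 2) <= x ^+ 2.
  rewrite /x; case: (leP (Num.sqrt M)) => _.
    rewrite sqr_sqrtr //; apply: le_trans (_ : kappa * M <= _).
      by rewrite ler_pM2l // ge_min lexx.
    by rewrite ler_piMl.
  apply: le_trans (_ : kappa * (1 / e ^+ 2) <= _).
    by rewrite ler_pM2l // ge_min lexx orbT.
  by rewrite /kappa [leRHS]exprMn exprVn div1r.
(* Rounding down could give 0; the value 1 is allowed because m(n) > 0. *)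
pose D := maxn 1 (Num.truncn x).
have D_gt0 : (0 < D)%N by rewrite leq_max.
have D_sqr : (D ^ 2 <= m n)%N.
  rewrite /D; case: (leqP 1 (Num.truncn x)) => // _.
  have : (Num.truncn x)%:R <= x by rewrite truncn_le.
  rewrite le_min => /andP[+ _]; rewrite -ler_sqr ?nnegrE ?sqrtr_ge0 // sqr_sqrtr //.
  by rewrite -natrX ler_nat.
have D_size b : of_size (7 * (k2 + 1)) n (m n) (gadget D_gt0 b).
  by apply: gadget_of_size => //; apply: ltW.
(* For small [x] the claimed bound is at most 1 and any gadget will do; otherwise q D >= 6. *)
have [x_small | x_large] := ltP x (6 / q + 1).
  exists (gadget D_gt0 finset.set0), (gnode D_gt0 finset.set0 Src); split=> //.
  rewrite le_max lee_fin; apply/orP; left.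
  have xq : x * q <= 7.
    apply: le_trans (_ : (6 / q + 1) * q <= _); first by rewrite ler_pM2r // ltW.
    by rewrite mulrDl divfK ?mul1r; [lra | rewrite gt_eqF].
  rewrite mulrAC ler_pdivrMr // [leRHS]mul1r mulrAC.
  apply: le_trans (_ : x ^+ 2 * q ^+ 2 <= _); first by rewrite ler_pM2r ?exprn_gt0.
  rewrite -exprMn; have : 0 <= x * q by rewrite mulr_ge0 // ltW.
  by nra.
have q6 : 6 <= 6 / q by rewrite ler_pdivlMr //; lra.
have DE : D = Num.truncn x.
  by apply/maxn_idPr; rewrite truncn_gt0; lra.
have /andP[D_le_x x_lt_D] : D%:R <= x < D.+1%:R by rewrite DE truncn_itv.
have D_ge : 6 / q <= D%:R by rewrite -natr1 in x_lt_D; lra.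
have qD : 6 <= q * D%:R by rewrite ler_pdivrMr // mulrC in D_ge.
have x_le_2D : x <= 2 * D%:R by rewrite -natr1 in x_lt_D; lra.
have window : 2 * (e * (D ^ 2)%:R / gamma) <= q * D%:R / 6.
  have : D%:R <= q * gamma / 12 / e by apply: le_trans x_le.
  rewrite ler_pdivlMr // => De; rewrite natrX mulrA ler_pdivrMr //.
  have D0 : 0 <= D%:R :> R by [].
  by have := ler_wpM2r D0 De; nra.
(* Rounding up costs at most 1 <= q D / 6, whence w <= q D / 3. *)
pose w := (Num.truncn (2 * (e * (D ^ 2)%:R / gamma))).+1.
have w_gt : 2 * (e * (D ^ 2)%:R / gamma) < w%:R by rewrite truncnS_gt.
have w_le : w%:R <= q * D%:R / 3.
  rewrite /w -natr1; have : (Num.truncn (2 * (e * (D ^ 2)%:R / gamma)))%:R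
      <= 2 * (e * (D ^ 2)%:R / gamma).
    rewrite truncn_le; apply: mulr_ge0 => //; apply: divr_ge0; last exact: ltW.
    by apply: mulr_ge0 => //; apply: ltW.
  by lra.
have L_gt0 : 0 < (D ^ 2)%:R / 2 :> R by rewrite divr_gt0 // ltr0n expn_gt0 D_gt0.
(* With beta = q / 2 and L = D^2 / 2 this reads q^2 D^2 / 9 <= q^2 D^2 / 8. *)
have w_sqr : w%:R ^+ 2 <= (q / 2) ^+ 2 * ((D ^ 2)%:R / 2).
  have : w%:R ^+ 2 <= (q * D%:R / 3) ^+ 2.
    by rewrite ler_sqr ?nnegrE //; apply: le_trans w_le.
  have : 0 <= (q * D%:R) ^+ 2 by rewrite sqr_ge0.
  by rewrite natrX !exprMn; lra.
have [b many] : exists b, (((q - q / 2) * ((D ^ 2)%:R / 2))%:E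
    <= expected_queries A (gnode D_gt0 b Src))%E.
  apply: (@exists_many_queries D D_gt0 R alpha e _ (q / 2) q A L_gt0).
  - by rewrite divr_ge0 // ltW.
  - move=> K c est K_lt.
    by apply: sum_accurate_cylinder alpha01 w_gt _ w_sqr K_lt; rewrite divr_ge0 // ltW.
  - by move=> b; apply: A_succeeds.
exists (gadget D_gt0 b), (gnode D_gt0 b Src); split=> //.
rewrite le_max; apply/orP; right; apply: le_trans many; rewrite lee_fin.
(* Since x <= 2 D, the minimum times [kappa] is at most 4 D^2, to be compared with the q D^2 / 4
   queries found. *)
have : kappa * Num.min M (1 / e ^+ 2) <= 4 * (D ^ 2)%:R.
  apply: le_trans x_sqr _; rewrite natrX.
  by have := lerXn2r 2 x_ge0 (le_trans x_ge0 x_le_2D) x_le_2D; rewrite exprMn; lra.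
have : 0 <= q * (D ^ 2)%:R by rewrite mulr_ge0 // ltW.
have : q ^+ 2 <= q by rewrite expr2 ger_pMl.
set t := kappa * _; have -> : kappa * q ^+ 2 / 49 * Num.min M (1 / e ^+ 2) = q ^+ 2 * t / 49.
  by rewrite /t; ring.
have := exprn_gt0 2 q_gt0; set D2 : R := (D ^ 2)%:R => q2 q2_le qD2 t_le.
have : q ^+ 2 * t <= q ^+ 2 * (4 * D2) by rewrite ler_pM2l.
have : q ^+ 2 * D2 <= q * D2 by rewrite ler_wpM2r // ler0n.
by lra.
Unshelve. all: by end_near.
Qed.
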